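(* Let $D$ be a knot diagram and let $2\le k\le\infty$. Then in every version of the $k$-color region select game on $D$, the diagram $D$ is always solvable. Moreover, fix any two adjacent regions $r,r'$ of $D$. Then every color configuration $\mathbf c\in\mathbb{Z}_k^n$ has a unique solving pattern $\mathbf p$ with $\mathbf p(r)=\mathbf p(r')=0$.
   Context: Diagrams: a link (knot) diagram $D$ is the underlying graph of a regular projection of a link (knot) into $S^2$. Its vertices are the crossings, each of valence 4, and over/under information is ignored. Components without crossings are closed loops, each regarded as one edge with no vertices. Regions of $D$ are the connected components of $S^2\setminus D$. A vertex or edge is incident to a region if it lies in the boundary of that region. Two regions are adjacent if they are incident to a common edge. A vertex $v$ is reducible if some circle in $S^2$ meets $D$ transversely only at $v$, and irreducible otherwise. An irreducible vertex is incident to four distinct regions. A reducible vertex $v$ is incident to exactly three regions $r_0,r_1,r_2$, where $r_0$ touches $v$ from two sides and $r_1,r_2$ touch it from one side. A knot diagram with $n$ vertices has $n+2$ regions. A knot diagram is reduced if all its vertices are irreducible. Ring: for an integer $k\ge2$ let $\mathbb{Z}_k=\mathbb{Z}/k\mathbb{Z}$, and for $k=\infty$ let $\mathbb{Z}_\infty=\mathbb{Z}$. Game versions: a version of the $k$-color region select game on $D$ is a choice of an increment number $a(v,r)\in\mathbb{Z}_k$ for every incident vertex–region pair, subject to the following rules. - If $k<\infty$ and $v$ is irreducible, then $a(v,r)=a_v$ is the same for all regions $r$ incident to $v$, and $a_v$ is not a zero divisor of $\mathbb{Z}_k$. - If $k<\infty$ and $v$ is reducible, then $a(v,r_0)$ is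 arbitrary, while $a(v,r_1)$ and $a(v,r_2)$ are not zero divisors. - If $k=\infty$, then $a(v,r)=1$, except that $a(v,r_0)\in\mathbb{Z}$ is arbitrary when $v$ is reducible. - The original game is the version in which all increment numbers equal $1$. Game matrix: enumerate the vertices as $v_1,\dots,v_n$ and the regions as $r_1,\dots,r_m$. The game matrix is the $n\times m$ matrix $M$ over $\mathbb{Z}_k$ with $M_{ij}=a(v_i,r_j)$ if $v_i$ is incident to $r_j$, and $M_{ij}=0$ otherwise. Patterns and configurations: a push pattern is a vector $\mathbf p\in\mathbb{Z}_k^m$, and $\mathbf p(r_j)=p_j$ is the number of times $r_j$ is pushed. A region $r$ is not pushed in $\mathbf p$ if $\mathbf p(r)=0$. A color configuration is a vector $\mathbf c\in\mathbb{Z}_k^n$. Applying $\mathbf p$ to $\mathbf c$ yields $\mathbf c+M\mathbf p$. The configuration $\mathbf c$ is solvable if some $\mathbf p$ satisfies $M\mathbf p=-\mathbf c$; such a $\mathbf p$ is a solving pattern for $\mathbf c$. $D$ is always solvable in the version if every $\mathbf c\in\mathbb{Z}_k^n$ is solvable. A null pattern is an element of $Ker_k(M)=\{\mathbf p\in\mathbb{Z}_k^m: M\mathbf p=0\}$. *)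

(* Defs.v *)
From HB Require Import structures.
From mathcomp Require Import all_boot all_order all_algebra.
Set Implicit Arguments. Unset Strict Implicit. Unset Printing Implicit Defensive.
Import GRing.Theory.
Local Open Scope ring_scope.

(* A diagram is encoded combinatorially as a map (rotation system) on darts:
   - [vert d]  : the crossing (vertex) at which dart (half-edge) d starts;
   - [rot]     : cyclic order of the 4 darts around a vertex (so that
                 [rot (rot d)] is the dart opposite to d, i.e. the strand
                 goes straight through the crossing from d to rot (rot d));
   - [opp]     : the other half of the edge containing d;
   - [face d]  : the region (face) whose boundary contains the corner
                 following dart d. Regions are orbits of [rot \o opp]. *)
Record diagram := Diagram {
  vtx : finType;
  dart : finType;
  reg : finType;
  vert : dart -> vtx;
  rot : dart -> dart;
  opp : dart -> dart;
  face : dart -> reg }.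

Arguments vert {D} _ : rename.
Arguments rot {D} _ : rename.
Arguments opp {D} _ : rename.
Arguments face {D} _ : rename.

Definition strand (D : diagram) : rel (dart D) :=
  fun x y => (y == opp x) || (y == rot (rot x)).

(* D is a knot diagram on S^2 (possibly with no crossings: then it has no
   darts and exactly two regions, those on either side of the circle). *)
Definition knot_diagram (D : diagram) : Prop :=
  (injective (@rot D) /\ (forall d : dart D, vert (rot d) = vert d)) /\
      (forall v : vtx D, #|[set d | vert d == v]| = 4%N) /\
      (forall d e : dart D, vert d = vert e -> fconnect rot d e) /\
      (forall d : dart D, opp (opp d) = d /\ opp d != d) /\
      (forall d e : dart D,
          face d = face e <-> fconnect (fun x => rot (opp x)) d e) /\
      ((0 < #|dart D|)%N -> forall r : reg D, exists d, face d = r) /\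
      (* Euler characteristic 2: the diagram lies on the sphere *)
      #|reg D| = (#|vtx D| + 2)%N /\
      (* a single component: all darts lie on one strand *)
      (forall d e : dart D, connect (@strand D) d e).

Definition incident (D : diagram) (v : vtx D) (r : reg D) : bool :=
  [exists d, (vert d == v) && (face d == r)].

Definition touches_twice (D : diagram) (v : vtx D) (r : reg D) : Prop :=
  exists d e : dart D,
    [/\ d != e, vert d = v, vert e = v, face d = r & face e = r].

Definition reducible (D : diagram) (v : vtx D) : Prop :=
  exists r, touches_twice v r.

(* regions r and r' are adjacent: they are incident to a common edge
   (in the crossingless diagram, the unique edge is the circle itself). *)
Definition adjacent (D : diagram) (r r' : reg D) : Prop :=
  r != r' /\ ((exists d : dart D, face d = r /\ face (opp d) = r')
              \/ #|dart D| = 0%N).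

Definition not_zero_divisor (R : comRingType) (x : R) : Prop :=
  forall y : R, x * y = 0 -> y = 0.

(* versions of the game for finite k (R = 'Z_k) *)
Definition version_fin (D : diagram) (R : comRingType)
    (a : vtx D -> reg D -> R) : Prop :=
  forall v : vtx D,
    (~ reducible v ->
       exists av : R, not_zero_divisor av /\
         forall r, incident v r -> a v r = av) /\
    (reducible v ->
       forall r, incident v r -> ~ touches_twice v r ->
         not_zero_divisor (a v r)).

Definition version_inf (D : diagram) (a : vtx D -> reg D -> int) : Prop :=
  forall v r, incident v r -> ~ touches_twice v r -> a v r = 1.

Definition game_matrix (D : diagram) (R : comRingType)
    (a : vtx D -> reg D -> R) (v : vtx D) (r : reg D) : R :=
  if incident v r then a v r else 0.

Definition solving_pattern (D : diagram) (R : comRingType)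
    (a : vtx D -> reg D -> R) (c : vtx D -> R) (p : {ffun reg D -> R}) : Prop :=
  forall v : vtx D, \sum_(r : reg D) game_matrix a v r * p r = - c v.

Definition always_solvable (D : diagram) (R : comRingType)
    (a : vtx D -> reg D -> R) : Prop :=
  forall c : vtx D -> R, exists p : {ffun reg D -> R}, solving_pattern a c p.

Definition game_conclusion (D : diagram) (R : comRingType)
    (a : vtx D -> reg D -> R) : Prop :=
  always_solvable a /\
  forall r r' : reg D, adjacent r r' ->
    forall c : vtx D -> R,
      exists! p : {ffun reg D -> R},
        p r = 0 /\ p r' = 0 /\ solving_pattern a c p.

(* Main.v *)
Require Import Defs.
From mathcomp Require Import all_boot all_order all_algebra.
Set Implicit Arguments. Unset Strict Implicit. Unset Printing Implicit Defensive.
Import GRing.Theory.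

Local Notation rot := Defs.rot.
Local Notation opp := Defs.opp.

(* For a pattern [p], let the balance of an edge be the sum of [p] over its two
   sides. If [p] is a null pattern, the balance changes sign when a strand
   crosses an irreducible vertex, while at a reducible vertex the two edges
   around a lobe have the same sides, hence the same balance. Let [A] be the
   part of the knot cut off at an irreducible vertex. Since cycles on the sphere
   are boundaries, [A] uses both or neither of the two edges around a lobe, so
   along [A] the balance turns from zero to nonzero, or back, an even number of
   times. Hence one zero balance at an irreducible vertex forces all four, and
   the zeros of [p] on two adjacent regions propagate to all regions.
   Deleting the columns of two adjacent regions therefore leaves a square
   matrix with trivial kernel over every coefficient ring. Over a finite ring it
   is bijective; over [int] its determinant is nonzero modulo every prime,
   hence a unit. *)

Section KnotDiagram.

Local Open Scope ring_scope.

Variable D : diagram.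
Hypothesis HD : knot_diagram D.
Implicit Types (d e x y z : dart D) (v w : vtx D) (r : reg D).

(** * Darts around a crossing and induction along the knot *)

Lemma rot_inj : injective (@rot D).
Proof. by case: HD => -[]. Qed.

Lemma vert_rot d : vert (rot d) = vert d.
Proof. by case: HD => -[]. Qed.

Lemma card_vert v : #|[set d | vert d == v]| = 4%N.
Proof. by case: HD => _ []. Qed.

Lemma fconnect_vert d e : vert d = vert e -> fconnect rot d e.
Proof. by case: HD => _ [_ [H _]]; apply: H. Qed.

Lemma oppK : involutive (@opp D).
Proof. by case: HD => _ [_ [_ [H _]]] d; case: (H d). Qed.

Lemma opp_neq d : opp d != d.
Proof. by case: HD => _ [_ [_ [H _]]]; case: (H d). Qed.

Lemma face_opp d : face (opp d) = face (rot d).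
Proof.
case: HD => _ [_ [_ [_ [H _]]]]; apply/H.
by rewrite -{2}[d]oppK; apply: fconnect1.
Qed.

Lemma face_surj d r : exists e, face e = r.
Proof.
case: HD => _ [_ [_ [_ [_ [H _]]]]]; apply: H.
by apply/card_gt0P; exists d.
Qed.

Lemma card_reg : #|reg D| = (#|vtx D| + 2)%N.
Proof. by case: HD => _ [_ [_ [_ [_ [_ []]]]]]. Qed.

(** Turns the single-component condition into an induction principle: following edges and going
    straight through crossings reaches every dart. *)
Lemma strand_ind (P : pred (dart D)) d :
    (forall x, P x -> P (opp x)) -> (forall x, P x -> P (rot (rot x))) ->
  P d -> forall e, P e.
Proof.
move=> Popp Prot Pd e.
have: connect (@strand D) d e by case: HD => _ [_ [_ [_ [_ [_ []]]]]].
case/connectP=> s; elim: s d Pd => [|x s IHs] d Pd /= => [_ -> //|].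
case/andP=> dx; apply: IHs.
by case/orP: dx => /eqP ->; [apply: Popp | apply: Prot].
Qed.

Lemma rot_ind (P : pred (dart D)) d :
    (forall x, P x -> P (opp x)) -> (forall x, P x -> P (rot x)) ->
  P d -> forall e, P e.
Proof.
by move=> Popp Prot Pd; apply: strand_ind Pd => // x Px; apply/Prot/Prot.
Qed.

Lemma order_rot d : order rot d = 4%N.
Proof.
rewrite -(card_vert (vert d)) /order; apply: eq_card => e; rewrite !inE.
apply/idP/eqP=> [|E]; last exact: fconnect_vert.
case/iter_findex => <-; elim: (findex _ _ _) => //= n IHn.
by rewrite vert_rot.
Qed.

Lemma orbit_rot d :
  orbit rot d = [:: d; rot d; rot (rot d); rot (rot (rot d))].
Proof. by rewrite /orbit order_rot. Qed.

Lemma rot4 d : rot (rot (rot (rot d))) = d.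
Proof. by have := iter_order rot_inj d; rewrite order_rot. Qed.

Lemma uniq_rot d : uniq [:: d; rot d; rot (rot d); rot (rot (rot d))].
Proof. by rewrite -orbit_rot orbit_uniq. Qed.

Lemma mem_vert d e : (vert e == vert d) =
  (e \in [:: d; rot d; rot (rot d); rot (rot (rot d))]).
Proof.
rewrite -orbit_rot -fconnect_orbit; apply/eqP/idP=> [E|].
  exact: fconnect_vert.
case/iter_findex => <-; elim: (findex _ _ _) => //= n IHn.
by rewrite vert_rot.
Qed.

Lemma sum_vert (V : zmodType) (F : dart D -> V) d :
  \sum_(e | vert e == vert d) F e =
  F d + F (rot d) + F (rot (rot d)) + F (rot (rot (rot d))).
Proof.
rewrite (eq_bigl _ _ (mem_vert d)) -big_uniq ?uniq_rot //=.
by rewrite !big_cons big_nil addr0 !addrA.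
Qed.

Lemma vert_dart v : exists d, vert d = v.
Proof.
have: (0 < #|[set d | vert d == v]|)%N by rewrite card_vert.
by case/card_gt0P => d; rewrite inE => /eqP; exists d.
Qed.

Lemma card_dart : #|dart D| = (4 * #|vtx D|)%N.
Proof.
rewrite -sum1_card (partition_big (@vert D) predT) //=.
rewrite (eq_bigr (fun=> 4%N)) => [|v _]; first by rewrite sum_nat_const mulnC.
rewrite sum1_card -[RHS](card_vert v).
by apply: eq_card => d; rewrite !inE.
Qed.

(** * Mod 2 cycles bound *)

(* The field of two elements is [bool], with [addb] as addition. *)
Definition mod2_cycle (A : dart D -> bool) : Prop :=
  (forall d, A (opp d) = A d) /\ (forall v, \sum_(d | vert d == v) A d = 0).

(** Represents each edge by one of its two darts; the enumeration order serves only to choose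
    between them. *)
Definition edge_repr : {set dart D} :=
  [set d | (enum_rank d < enum_rank (opp d))%N].

Lemma edge_reprC d : (opp d \in edge_repr) = (d \notin edge_repr).
Proof.
rewrite !inE oppK -leqNgt [RHS]leq_eqVlt.
by rewrite -[X in X || _]/(enum_rank _ == enum_rank _)
  (inj_eq enum_rank_inj) (negPf (opp_neq d)).
Qed.

Lemma sum_edges (V : zmodType) (F : dart D -> V) :
  \sum_d F d = \sum_(d in edge_repr) (F d + F (opp d)).
Proof.
rewrite big_split /= (bigID (mem edge_repr)) /=; congr (_ + _).
rewrite (reindex_inj (can_inj oppK)) /=.
by apply: eq_bigl => d; rewrite edge_reprC negbK.
Qed.

Lemma card_edges : (#|edge_repr| <= 2 * #|vtx D|)%N.
Proof.
have: (#|edge_repr| + #|[set opp d | d in edge_repr]| <= #|dart D|)%N.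
  rewrite -cardsUI [X in (_ + X)%N](_ : _ = 0%N) ?addn0 ?max_card //.
  apply/eqP; rewrite cards_eq0 -subset0; apply/subsetP=> d.
  rewrite in_setI => /andP[dE /imsetP[e eE def_d]].
  by move: dE; rewrite def_d edge_reprC eE.
rewrite card_imset; last exact: can_inj oppK.
by rewrite card_dart addnn -muln2 -[4%N]/(2 * 2)%N -mulnA mulnC leq_pmul2l.
Qed.

(* Incidence of the cells of one kind (vertices or regions) with the edges:
   both ends, or both sides, of an edge count. *)
Definition incidence_mx (T : finType) (l : dart D -> T) :
    'M[bool]_(#|T|, #|edge_repr|) :=
  \matrix_(i, j) ((l (enum_val j) == enum_val i) +
                  (l (opp (enum_val j)) == enum_val i)).

Lemma mul_incidence_mx (T : finType) (l : dart D -> T)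
    (u : 'rV[bool]_#|T|) j :
  (u *m incidence_mx l) 0 j = u 0 (enum_rank (l (enum_val j))) +
                             u 0 (enum_rank (l (opp (enum_val j)))).
Proof.
have sumE t : \sum_i u 0 i * (t == enum_val i) = u 0 (enum_rank t).
  rewrite (bigD1 (enum_rank t)) //= enum_rankK eqxx mulr1 big1 ?addr0 // => i.
  by case: (t =P enum_val i) => [->|_ _]; rewrite ?enum_valK ?eqxx ?mulr0.
by rewrite mxE -!sumE -big_split; apply: eq_bigr => i _; rewrite mxE mulrDr.
Qed.

(** A vector in the left kernel agrees on the two cells met by each edge. The hypothesis, a form of
    connectedness, makes it constant, so the kernel has dimension at most 1. *)
Lemma rank_incidence_mx (T : finType) (l : dart D -> T) :
    (forall u : T -> bool, (forall d, u (l (opp d)) = u (l d)) ->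
      exists b, forall t, u t = b) ->
  (#|T| - 1 <= \rank (incidence_mx l))%N.
Proof.
move=> Hl; rewrite leq_subLR addnC -leq_subLR -mxrank_ker.
apply: leq_trans (rank_leq_row (const_mx 1 : 'rV[bool]_#|T|)).
apply/mxrankS/rV_subP => u /sub_kermxP u0.
have [|b ub] := Hl (fun t => u 0 (enum_rank t)).
  have key d : d \in edge_repr ->
      u 0 (enum_rank (l (opp d))) = u 0 (enum_rank (l d)).
    move=> dE; have := mul_incidence_mx l u (enum_rank_in dE d).
    rewrite u0 mxE enum_rankK_in //.
    by case: (u 0 _); case: (u 0 _).
  move=> d; case: (boolP (d \in edge_repr)) => [/key //|].
  by rewrite -edge_reprC => /key; rewrite oppK.
have -> : u = b *: const_mx 1.
  by apply/rowP=> i; rewrite !mxE mulr1 -(ub (enum_val i)) enum_valK.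
exact: scalemx_sub.
Qed.

Lemma rank_vert : (#|vtx D| - 1 <= \rank (incidence_mx (@vert D)))%N.
Proof.
apply: rank_incidence_mx => u Hu.
case: (pickP (mem (vtx D))) => [v0 _|v0]; last first.
  by exists true => v; have := v0 v.
have [d0 _] := vert_dart v0; exists (u (vert d0)) => v.
have [d <-] := vert_dart v; apply/eqP; move: d.
by apply: (@rot_ind _ d0) => // d /eqP <-; rewrite ?Hu ?vert_rot.
Qed.

Lemma rank_face d0 : (#|reg D| - 1 <= \rank (incidence_mx (@face D)))%N.
Proof.
apply: rank_incidence_mx => u Hu.
exists (u (face d0)) => r; have [d <-] := face_surj d0 r; apply/eqP; move: d.
by apply: (@rot_ind _ d0) => // d /eqP <-; rewrite -?face_opp Hu.
Qed.

(** As [face (opp d)] is the next corner [face (rot d)], the sum around a vertex counts each corner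
    twice. *)
Lemma boundary_cycle (S : reg D -> bool) :
  mod2_cycle (fun d => S (face d) + S (face (opp d))).
Proof.
split=> [d|v]; first by rewrite oppK addrC.
rewrite big_split /= [X in _ + X](_ : _ = \sum_(d | vert d == v) S (face d)).
  by case: (\sum_(d | _) _).
rewrite [RHS](reindex_inj rot_inj) /=.
by apply: eq_big => d; rewrite ?vert_rot // face_opp.
Qed.

Lemma cycle_orthogonal A : mod2_cycle A ->
  (\row_(j < #|edge_repr|) A (enum_val j)) *m (incidence_mx (@vert D))^T = 0.
Proof.
case=> Aopp Av; apply/rowP=> i; rewrite !mxE.
under eq_bigr do rewrite !mxE.
rewrite -(big_enum_val (fun d => A d *
  ((vert d == enum_val i) + (vert (opp d) == enum_val i)))) /=.
rewrite -[RHS](Av (enum_val i)) [RHS]big_mkcond /= sum_edges.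
apply: eq_bigr => d _; rewrite Aopp.
by case: (A d); case: eqP; case: eqP.
Qed.

(* H_1 of the sphere vanishes: boundaries are cycles, and by Euler's formula
   the two spaces have the same dimension. *)
Lemma cycle_boundary A : mod2_cycle A ->
  exists S : reg D -> bool, forall d, A d = S (face d) + S (face (opp d)).
Proof.
move=> HA.
case: (pickP (mem (dart D))) => [d0 _|D0]; last first.
  by exists xpredT => d; have := D0 d.
set B := incidence_mx (@vert D); set C := incidence_mx (@face D).
have CB : (C <= kermx B^T)%MS.
  apply/sub_kermxP/row_matrixP => i; rewrite row_mul row0.
  rewrite -[RHS](cycle_orthogonal (boundary_cycle (pred1 (enum_val i)))).
  by congr (_ *m _); apply/rowP=> j; rewrite !mxE.
(* With V vertices, the kernel has dimension at most 2V - (V - 1) = V + 1. This is one less than the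
   number of regions, hence at most the rank of [C]. *)
have BC : (kermx B^T <= C)%MS.
  rewrite -(geq_leqif (mxrank_leqif_sup CB)) mxrank_ker mxrank_tr.
  apply: leq_trans (rank_face d0); rewrite card_reg.
  have := card_edges; have := rank_vert; rewrite -/B.
  have: (0 < #|vtx D|)%N by apply/card_gt0P; exists (vert d0).
  move: (\rank B) => b.
  case: #|vtx D| => // n _; rewrite subn1 /= => Hn HE.
  rewrite leq_subLR (leq_trans HE) // addn2 subn1 /=.
  by rewrite mul2n -addnn addSn -addnS leq_add.
have /submxP[u Hu] := submx_trans (introT sub_kermxP (cycle_orthogonal HA)) BC.
exists (fun r => u 0 (enum_rank r)).
have key d : d \in edge_repr -> A d =
    u 0 (enum_rank (face d)) + u 0 (enum_rank (face (opp d))).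
  move=> dE; have /rowP/(_ (enum_rank_in dE d)) := Hu.
  by rewrite mul_incidence_mx mxE enum_rankK_in.
move=> d; case: (boolP (d \in edge_repr)) => [/key //|].
by rewrite -edge_reprC => /key; rewrite oppK (proj1 HA) addrC.
Qed.

(** Handshake argument: each edge contributes twice to the sum over all vertices, so the total
    vanishes. *)
Lemma vert_parity (g : dart D -> bool) w :
    (forall d, g (opp d) = g d) ->
    (forall v, v != w -> \sum_(d | vert d == v) g d = 0) ->
  \sum_(d | vert d == w) g d = 0.
Proof.
move=> gopp gv; transitivity (\sum_d g d).
  rewrite [RHS](partition_big (@vert D) predT) //= [RHS](bigD1 w) //=.
  by rewrite [X in _ = _ + X]big1 ?addr0 // => v vw; rewrite -[RHS](gv v vw).
by rewrite sum_edges big1 // => d _; rewrite gopp; case: (g d).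
Qed.

(** * Loops and reducible crossings *)

(* The half of the knot cut off at the crossing of [x]: leave along [x] and
   stop at the first return, which is through a neighbour of [x]. *)
Lemma loop_at x : exists (A : dart D -> bool) y,
  [/\ y = rot x \/ y = rot (rot (rot x)),
      forall d, A (opp d) = A d,
      forall d, vert d != vert x -> A (rot (rot d)) = A d
    & forall d, vert d = vert x -> A d = (d == x) || (d == y)].
Proof.
(* [s] runs along an edge and straight through the crossing at its end. *)
pose s d := rot (rot (opp d)).
have s_inj : injective s by move=> a b /rot_inj/rot_inj/(can_inj oppK).
have exm : exists m, (0 < m)%N && (vert (iter m s x) == vert x).
  by exists (order s x); rewrite order_gt0 iter_order ?eqxx.
case: (ex_minnP exm) => m /andP[m_gt0 /eqP vm] min_m {exm}.
have vNx i : (0 < i < m)%N -> vert (iter i s x) != vert x.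
  case/andP=> i_gt0 im; apply/negP=> vi.
  by have := min_m i; rewrite i_gt0 vi leqNgt im => /(_ isT).
pose A d := [exists i : 'I_m, (d == iter i s x) || (d == opp (iter i s x))].
have AP d : reflect (exists2 i, (i < m)%N & d = iter i s x \/ d = opp (iter i s x))
                    (A d).
  apply: (iffP existsP) => [[i /orP di]|[i im di]].
    by exists i => //; case: di => /eqP; [left | right].
  by exists (Ordinal im); apply/orP; case: di => ->; [left | right].
have Aopp d : A (opp d) = A d.
  suff impl e : A e -> A (opp e) by apply/idP/idP=> /impl; rewrite ?oppK.
  by case/AP=> i im [] ->; apply/AP; exists i => //; [right | left; rewrite oppK].
(* The dart through which the strand first comes back to the crossing of [x]. *)
pose y := opp (iter m.-1 s x).
have y_rot2 : rot (rot y) = iter m s x by rewrite -[in RHS](prednK m_gt0).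
have vy : vert y = vert x by rewrite -vm -y_rot2 !vert_rot.
have Arot d : vert d != vert x -> A (rot (rot d)) = A d.
  have impl e : vert e != vert x -> A e -> A (rot (rot e)).
    move=> ve /AP[i im [] def_e]; last first.
      have se : rot (rot e) = iter i.+1 s x by rewrite def_e.
      apply/AP; exists i.+1; last by left.
      rewrite ltn_neqAle im andbT; apply: contraNneq ve => iE.
      by rewrite -vm -iE -se !vert_rot.
    case: i im def_e => [|i] im def_e; first by rewrite def_e eqxx in ve.
    apply/AP; exists i; first exact: ltnW.
    by right; rewrite def_e /= rot4.
  move=> vd; apply/idP/idP; last exact: impl.
  by move/impl; rewrite !vert_rot rot4; apply.
have Ax d : vert d = vert x -> A d = (d == x) || (d == y).
  move=> vd; apply/AP/orP=> [[i im [] def_d]|[] /eqP ->].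
  - left; case: i im def_d => [|i] im def_d; first by rewrite def_d.
    by have := vNx i.+1 im; rewrite -def_d vd eqxx.
  - right; have vS : vert (iter i.+1 s x) = vert x.
      by rewrite -vd def_d /= /s !vert_rot.
    rewrite def_d /y; case: (ltngtP i.+1 m) im => // [im _|<- //].
    by have := vNx i.+1 im; rewrite vS eqxx.
  - by exists 0%N => //; left.
  - by exists m.-1; [rewrite prednK | right].
exists A, y; split=> //.
have := mem_vert x y; rewrite vy eqxx !inE => /esym/or4P[] /eqP def_y.
(* If [y] were [x], the loop would have one dart at this crossing and an even number at every other
   one. *)
- have := @vert_parity A (vert x) Aopp.
  rewrite sum_vert !Ax ?vert_rot // def_y.
  have := uniq_rot x; rewrite /= !inE !negb_or eqxx.
  rewrite ![_ == x]eq_sym => /and4P[/and3P[/negPf-> /negPf-> /negPf->] _ _ _].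
  move=> H; exfalso; suff: true + false + false + false = false by [].
  apply: H => v vx; have [d vd] := vert_dart v; rewrite -vd in vx *.
  rewrite sum_vert !Arot ?vert_rot //.
  by case: (A d); case: (A (rot d)).
- by left.
(* If [y] were opposite to [x], the loop would close up straight and be the whole knot, yet it
   misses [rot x]. *)
- have all_A : forall e, A e.
    apply: (@strand_ind A x) => [e|e|]; first by rewrite Aopp.
      case: (eqVneq (vert e) (vert x)) => [ve|/Arot-> //].
      rewrite !Ax ?vert_rot // def_y => /orP[] /eqP->; rewrite ?eqxx ?orbT //.
      by rewrite rot4 eqxx.
    by rewrite Ax // eqxx.
  have := all_A (rot x); rewrite Ax ?vert_rot // def_y.
  have := uniq_rot x; rewrite /= !inE !negb_or.
  rewrite [rot x == x]eq_sym.
  by case/and4P=> /and3P[/negPf-> _ _] /andP[/negPf-> _].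
- by right.
Qed.

Lemma loop_cycle A x y :
    y = rot x \/ y = rot (rot (rot x)) ->
    (forall d, A (opp d) = A d) ->
    (forall d, vert d != vert x -> A (rot (rot d)) = A d) ->
    (forall d, vert d = vert x -> A d = (d == x) || (d == y)) ->
  mod2_cycle A.
Proof.
move=> y_rot Aopp Arot Ax; split=> // v; have [d <-] := vert_dart v.
case: (eqVneq (vert d) (vert x)) => [->|vd]; last first.
  rewrite sum_vert !Arot ?vert_rot //.
  by case: (A d); case: (A (rot d)).
rewrite sum_vert !Ax ?vert_rot //; have := uniq_rot x; rewrite /= !inE !negb_or.
case: y_rot => ->; rewrite !eqxx ![_ == x]eq_sym.
  rewrite ![_ == rot x]eq_sym.
  by case/and4P=> /and3P[/negPf-> /negPf-> /negPf->] /andP[/negPf-> /negPf->].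
by case/and4P=> /and3P[/negPf-> /negPf-> /negPf->] /andP[_ /negPf->] /negPf->.
Qed.

(** Checkerboard colouring: all valences are even, so the set of all edges is a cycle. A set of
    regions that it bounds separates the two sides of every edge. *)
Lemma face_rot_neq d : face (rot d) <> face d.
Proof.
move=> E; have allE : mod2_cycle (fun=> true).
  by split=> // v; have [e <-] := vert_dart v; rewrite sum_vert.
have [S /(_ d)] := cycle_boundary allE.
by rewrite face_opp E; case: (S _).
Qed.

(** The edges of [d] and [rot d] have the same two sides here, and a boundary is determined edge by
    edge by the sides. *)
Lemma cycle_reducible A d :
  mod2_cycle A -> face (rot (rot d)) = face d -> A (rot d) = A d.
Proof.
move=> HA E; have [S HS] := cycle_boundary HA.
by rewrite !HS !face_opp E addrC.
Qed.

(** Otherwise the loop at [d], being a cycle, would contain the opposite dart [rot (rot d)] along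
    with [d], whereas its second dart there is a neighbour of [d]. *)
Lemma reducible_face_neq d : face (rot (rot d)) = face d ->
  face (rot (rot (rot d))) <> face (rot d).
Proof.
move=> E E'; have [A [y [y_rot Aopp Arot Ax]]] := loop_at d.
have HA := loop_cycle y_rot Aopp Arot Ax.
have := cycle_reducible HA E'; rewrite (cycle_reducible HA E) !Ax ?vert_rot //.
have := uniq_rot d; rewrite /= !inE !negb_or eqxx.
rewrite ![_ == d]eq_sym ![_ == rot d]eq_sym.
case/and4P=> /and3P[_ /negPf-> _] /andP[n12 _] n23 _.
case: y_rot => ->; first by rewrite eq_sym (negPf n12).
by rewrite (negPf n23).
Qed.

(** Neighbouring corners lie in different regions, so a repeated region fills opposite corners. *)
Lemma touches_twiceP v r : touches_twice v r <->
  exists d, [/\ vert d = v, face d = r & face (rot (rot d)) = r].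
Proof.
split=> [[d [e [de vd ve fd fe]]]|[d [vd fd fd2]]]; last first.
  exists d, (rot (rot d)); rewrite !vert_rot; split=> //.
  by have := uniq_rot d; rewrite /= !inE !negb_or; case/andP=> /and3P[].
have := mem_vert d e; rewrite vd ve eqxx !inE eq_sym (negPf de) /=.
move/esym/or3P=> [] /eqP def_e.
- by case: (@face_rot_neq d); rewrite -def_e fd.
- by exists d; rewrite -def_e.
- by case: (@face_rot_neq e); rewrite fe def_e rot4.
Qed.

(** * Null patterns *)

Definition faces_at d : seq (reg D) :=
  [:: face d; face (rot d); face (rot (rot d)); face (rot (rot (rot d)))].

Lemma incidentE d r : incident (vert d) r = (r \in faces_at d).
Proof.
apply/existsP/idP=> [[e /andP[]]|].
  by rewrite mem_vert !inE => /or4P[] /eqP -> /eqP <-; rewrite eqxx ?orbT.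
rewrite !inE => /or4P[] /eqP ->;
  [exists d | exists (rot d) | exists (rot (rot d)) | exists (rot (rot (rot d)))];
  by rewrite ?vert_rot !eqxx.
Qed.

Section Game.

Variables (R : comNzRingType) (a : vtx D -> reg D -> R).
Hypothesis Ha : version_fin a.

Variable p : reg D -> R.
Hypothesis null_p : forall v, \sum_r game_matrix a v r * p r = 0.

(** A region filling two corners has a single matrix entry, hence [undup]. *)
Lemma null_sum d : \sum_(r <- undup (faces_at d)) a (vert d) r * p r = 0.
Proof.
rewrite -[RHS](null_p (vert d)) big_uniq ?undup_uniq // big_mkcond.
apply: eq_bigr => r _; rewrite /game_matrix incidentE mem_undup.
by case: ifP; rewrite ?mul0r.
Qed.

Lemma null_irreducible d :
    face (rot (rot d)) <> face d ->
    face (rot (rot (rot d))) <> face (rot d) ->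
  p (face d) + p (face (rot d)) + p (face (rot (rot d))) +
    p (face (rot (rot (rot d)))) = 0.
Proof.
move=> n02 n13.
have n01 := @face_rot_neq d; have n12 := @face_rot_neq (rot d).
have n23 := @face_rot_neq (rot (rot d)).
have := @face_rot_neq (rot (rot (rot d))); rewrite rot4 => n30.
have irr : ~ reducible (vert d).
  case=> r /touches_twiceP[e [/eqP]]; rewrite mem_vert !inE.
  by case/or4P=> /eqP-> <-; rewrite ?rot4 //; move/esym.
have [a0 [a0_nz a0E]] := (Ha (vert d)).1 irr.
have U : uniq (faces_at d).
  rewrite /= !inE !negb_or !andbT -!andbA.
  by do !(apply/andP; split); apply/eqP => F; have := esym F; auto.
have := null_sum d; rewrite undup_id //.
rewrite (eq_big_seq (fun r => a0 * p r)) => [|r rd]; last first.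
  by rewrite a0E // incidentE.
rewrite -big_distrr /= => /a0_nz.
by rewrite !big_cons big_nil addr0 !addrA.
Qed.

Lemma null_reducible d : face (rot (rot d)) = face d ->
  exists a0 a1 a2, [/\ not_zero_divisor a1, not_zero_divisor a2 &
    a0 * p (face d) + a1 * p (face (rot d)) +
      a2 * p (face (rot (rot (rot d)))) = 0].
Proof.
move=> E; have n13 := reducible_face_neq E.
have n01 := @face_rot_neq d; have n12 := @face_rot_neq (rot d).
have n23 := @face_rot_neq (rot (rot d)).
have := @face_rot_neq (rot (rot (rot d))); rewrite rot4 => n30.
have red : reducible (vert d) by exists (face d); apply/touches_twiceP; exists d.
have nzd e : vert e = vert d -> face (rot (rot e)) <> face e ->
    not_zero_divisor (a (vert d) (face e)).
  move=> ve ne; apply: (Ha (vert d)).2 => //.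
    by apply/existsP; exists e; rewrite ve !eqxx.
  case/touches_twiceP=> x [/eqP]; rewrite -ve mem_vert !inE.
  case/or4P=> /eqP-> //.
  - by move/face_rot_neq.
  - by move=> F; case: (@face_rot_neq (rot (rot (rot e)))); rewrite rot4.
exists (a (vert d) (face d)), (a (vert d) (face (rot d))),
  (a (vert d) (face (rot (rot (rot d))))); split.
- by apply: nzd; rewrite ?vert_rot.
- by apply: nzd; rewrite ?vert_rot // rot4 => /esym.
have := null_sum d; rewrite /= !inE E eqxx !orbT.
do ![case: eqP => [/esym //|_] || case: eqP => [//|_]] => /=.
by rewrite !big_cons big_nil /= addr0 addrCA addrA.
Qed.

(** Recording only whether the balance vanishes hides its sign changes and yields a mod 2
    quantity. *)
Definition unbalanced d : bool := p (face d) + p (face (rot d)) != 0.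

Lemma unbalanced_opp d : unbalanced (opp d) = unbalanced d.
Proof. by rewrite /unbalanced -face_opp oppK face_opp addrC. Qed.

Lemma unbalanced_irreducible d :
    face (rot (rot d)) <> face d ->
    face (rot (rot (rot d))) <> face (rot d) ->
  unbalanced (rot (rot d)) = unbalanced d.
Proof.
move=> n02 n13; have := null_irreducible n02 n13; rewrite -addrA /unbalanced.
by move/eqP; rewrite addr_eq0 => /eqP->; rewrite oppr_eq0.
Qed.

Lemma unbalanced_reducible d :
  face (rot (rot d)) = face d -> unbalanced (rot d) = unbalanced d.
Proof. by rewrite /unbalanced => ->; rewrite addrC. Qed.

(* Along the loop at [d], [unbalanced] changes only at reducible crossings,
   and there an even number of times, since the loop runs through both strands
   or neither. *)
Lemma unbalanced_rot d :
    face (rot (rot d)) <> face d ->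
    face (rot (rot (rot d))) <> face (rot d) ->
  unbalanced (rot d) = unbalanced d.
Proof.
move=> n02 n13; have [A [y [y_rot Aopp Arot Ad]]] := loop_at d.
have HA := loop_cycle y_rot Aopp Arot Ad.
have even_red e : face (rot (rot e)) = face e -> vert e != vert d ->
    \sum_(x | vert x == vert e) (A x && unbalanced x) = 0.
  move=> E ve; have F : face (rot (rot (rot (rot e)))) = face (rot (rot e)).
    by rewrite rot4.
  rewrite sum_vert.
  rewrite (cycle_reducible HA E) (cycle_reducible HA F) Arot //.
  rewrite (unbalanced_reducible E) (unbalanced_reducible F).
  by case: (A e); case: (unbalanced e); case: (unbalanced _).
have: \sum_(x | vert x == vert d) (A x && unbalanced x) = 0.
  apply: vert_parity => [e|v]; first by rewrite Aopp unbalanced_opp.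
  have [e <-] := vert_dart v => ve.
  case: (face (rot (rot e)) =P face e) => [E|n02e]; first exact: even_red.
  case: (face (rot (rot (rot e))) =P face (rot e)) => [E|n13e].
    by rewrite -vert_rot; apply: even_red; rewrite ?vert_rot.
  (* At another irreducible crossing opposite darts contribute equally and cancel. *)
  rewrite sum_vert !Arot ?vert_rot // unbalanced_irreducible //.
  rewrite (@unbalanced_irreducible (rot e)) ?rot4 //; last exact/nesym.
  by case: (A e); case: (A (rot e)); case: (unbalanced e);
     case: (unbalanced (rot e)).
(* The loop meets this crossing in [d] and one neighbour, and opposite darts have equal
   [unbalanced], so the zero sum equates the values at [d] and [rot d]. *)
rewrite sum_vert unbalanced_irreducible // (@unbalanced_irreducible (rot d)) //;
  last by rewrite rot4; apply/nesym.
rewrite !Ad ?vert_rot //; have := uniq_rot d; rewrite /= !inE !negb_or eqxx.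
case: y_rot => ->; rewrite ?eqxx ![_ == d]eq_sym ![_ == rot d]eq_sym.
  case/and4P=> /and3P[/negPf-> /negPf-> /negPf->] /andP[/negPf-> /negPf->] _ _.
  by case: (unbalanced d); case: (unbalanced (rot d)).
case/and4P=> /and3P[/negPf-> /negPf-> /negPf->] /andP[_ /negPf->] /negPf-> _.
by case: (unbalanced d); case: (unbalanced (rot d)).
Qed.

Lemma null_pattern_eq0 d0 :
  p (face d0) = 0 -> p (face (opp d0)) = 0 -> forall r, p r = 0.
Proof.
rewrite face_opp => p0 p0'.
pose N d := (p (face d) == 0) && (p (face (rot d)) == 0).
have HN : forall d, N d.
  apply: (@rot_ind N d0) => [d|d|]; last by rewrite /N p0 p0' eqxx.
    by rewrite /N -!face_opp oppK andbC.
  case/andP=> /eqP pd /eqP pd1; rewrite /N pd1 eqxx /=.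
  (* The next region is either [face d] again, or the only unknown in the equation of a reducible
     crossing, or controlled by the zero balance of [d]. *)
  case: (face (rot (rot d)) =P face d) => [-> | n02]; first by rewrite pd.
  case: (face (rot (rot (rot d))) =P face (rot d)) => [E|n13].
    have [a0 [a1 [a2 [a1_nz _]]]] := null_reducible E.
    by rewrite rot4 pd pd1 !mulr0 add0r addr0 => /a1_nz ->.
  have := unbalanced_rot n02 n13.
  rewrite /unbalanced pd pd1 addr0 add0r eqxx => /negbT.
  by rewrite negbK.
by move=> r; have [d <-] := face_surj d0 r; case/andP: (HN d) => /eqP.
Qed.

End Game.

(** * The game matrix without two adjacent regions *)

Lemma dart0_vtx0 : #|dart D| = 0%N -> #|vtx D| = 0%N.
Proof. by move/eqP; rewrite card_dart muln_eq0 => /eqP. Qed.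

Lemma card_others r r' : r != r' -> #|~: [set r; r']| = #|vtx D|.
Proof.
move=> rr'; have := cardsC [set r; r'].
by rewrite cards2 rr' card_reg addnC => /addIn.
Qed.

Lemma null_adjacent (R : comNzRingType) (a : vtx D -> reg D -> R)
    (p : reg D -> R) r r' :
    version_fin a -> (forall v, \sum_s game_matrix a v s * p s = 0) ->
    adjacent r r' -> p r = 0 -> p r' = 0 ->
  forall s, p s = 0.
Proof.
move=> Ha Hp [rr' [[d [<- <-]]|D0]] pr pr' s.
  exact: (null_pattern_eq0 Ha Hp pr pr' s).
(* Without crossings, [r] and [r'] are the only regions. *)
have /eqP := card_others rr'; rewrite (dart0_vtx0 D0) cards_eq0 => /eqP E.
have: s \notin ~: [set r; r'] by rewrite E inE.
by rewrite !inE negbK => /orP[] /eqP->.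
Qed.

Section ReducedMatrix.

Variables (r r' : reg D) (rr' : r != r').

(** Lists the remaining regions by an index over the number of vertices, which makes the reduced
    matrix square. *)
Definition other (j : 'I_#|vtx D|) : reg D :=
  enum_val (cast_ord (esym (card_others rr')) j).

Lemma other_inj : injective other.
Proof. by move=> i j /enum_val_inj/cast_ord_inj. Qed.

Lemma other_neq j : (r != other j) && (r' != other j).
Proof.
have := enum_valP (cast_ord (esym (card_others rr')) j).
by rewrite !inE negb_or ![_ == enum_val _]eq_sym.
Qed.

Definition reduced_mx (R : comNzRingType) (a : vtx D -> reg D -> R) :
    'M[R]_#|vtx D| := \matrix_(i, j) game_matrix a (enum_val i) (other j).

Definition extend (R : comNzRingType) (x : 'cV[R]_#|vtx D|) : {ffun reg D -> R} :=
  [ffun s => \sum_j x j 0 *+ (s == other j)].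

Section Extend.

Variables (R : comNzRingType) (a : vtx D -> reg D -> R) (x : 'cV[R]_#|vtx D|).

Lemma extend_l : extend x r = 0.
Proof.
rewrite ffunE big1 // => j _.
by case/andP: (other_neq j) => /negPf->.
Qed.

Lemma extend_r : extend x r' = 0.
Proof.
rewrite ffunE big1 // => j _.
by case/andP: (other_neq j) => _ /negPf->.
Qed.

Lemma extend_other j : extend x (other j) = x j 0.
Proof.
rewrite ffunE (bigD1 j) //= eqxx big1 ?addr0 // => i ij.
by rewrite (inj_eq other_inj) eq_sym (negPf ij).
Qed.

Lemma sum_extend i :
  \sum_s game_matrix a (enum_val i) s * extend x s = (reduced_mx a *m x) i 0.
Proof.
rewrite mxE; under eq_bigr do rewrite ffunE big_distrr /=.
rewrite exchange_big /=; apply: eq_bigr => j _.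
rewrite (bigD1 (other j)) //= eqxx big1 ?addr0 ?mxE // => s /negPf->.
by rewrite mulr0.
Qed.

End Extend.

Lemma reduced_mx_inj (R : comNzRingType) (a : vtx D -> reg D -> R)
    (x : 'cV_#|vtx D|) :
  adjacent r r' -> version_fin a -> reduced_mx a *m x = 0 -> x = 0.
Proof.
move=> adj Ha Hx; apply/matrixP=> j k; rewrite ord1 mxE -extend_other.
apply: (null_adjacent Ha _ adj); rewrite ?extend_l ?extend_r // => v.
by rewrite -(enum_rankK v) sum_extend Hx mxE.
Qed.

End ReducedMatrix.

(** Uniqueness already follows from [null_adjacent] applied to a difference of patterns, so only
    existence depends on the coefficient ring. *)
Lemma game_conclusion_surj (R : comNzRingType) (a : vtx D -> reg D -> R) :
    version_fin a ->
    (forall r r' (rr' : r != r'), adjacent r r' ->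
       forall c, exists x : 'cV_#|vtx D|, reduced_mx rr' a *m x = c) ->
  game_conclusion a.
Proof.
move=> Ha surj.
have ex r r' : adjacent r r' -> forall c : vtx D -> R,
    exists p : {ffun reg D -> R}, p r = 0 /\ p r' = 0 /\ solving_pattern a c p.
  move=> adj c; have [x Hx] := surj r r' adj.1 adj (\col_i (- c (enum_val i))).
  exists (extend adj.1 x); rewrite extend_l extend_r; do 2!split => //.
  by move=> v; rewrite -[v in LHS]enum_rankK sum_extend Hx mxE enum_rankK.
split=> [c|r r' adj c]; last first.
  have [p [pr [pr' Hp]]] := ex r r' adj c; exists p; split=> // q [qr [qr' Hq]].
  apply/ffunP=> s; apply/eqP; rewrite -subr_eq0; apply/eqP.
  apply: (null_adjacent (p := fun s => p s - q s) Ha _ adj);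
    rewrite ?pr ?pr' ?qr ?qr' ?subrr // => v.
  under eq_bigr do rewrite mulrBr.
  by rewrite sumrB Hp Hq subrr.
(* Any edge supplies an adjacent pair, since its two sides differ; without darts there are no
   equations. *)
case: (pickP (mem (dart D))) => [d _|D0].
  have adj : adjacent (face d) (face (opp d)).
    split; last by left; exists d.
    by rewrite face_opp eq_sym; apply/eqP/face_rot_neq.
  by have [p [_ [_ Hp]]] := ex _ _ adj c; exists p.
exists [ffun=> 0] => v; have [d _] := vert_dart v.
by have := D0 d.
Qed.

(** * Integer increments and reduction modulo primes *)

Lemma version_inf_fin (R : comNzRingType) (f : {rmorphism int -> R})
    (a : vtx D -> reg D -> int) :
  version_inf a -> version_fin (fun v r => f (a v r)).
Proof.
move=> Ha; have nz1 : not_zero_divisor (1 : R) by move=> y; rewrite mul1r.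
move=> v; split=> [irr|red r vr nt]; last by rewrite Ha // rmorph1.
exists 1; split=> // r vr; rewrite Ha ?rmorph1 // => tt.
by apply: irr; exists r.
Qed.

Lemma map_reduced_mx r r' (rr' : r != r') (R : comNzRingType)
    (f : {rmorphism int -> R}) (a : vtx D -> reg D -> int) :
  map_mx f (reduced_mx rr' a) = reduced_mx rr' (fun v s => f (a v s)).
Proof.
apply/matrixP=> i j; rewrite !mxE /game_matrix.
by case: ifP => // _; rewrite rmorph0.
Qed.

Lemma reduced_mx_unit r r' (rr' : r != r') (a : vtx D -> reg D -> int) :
  version_inf a -> adjacent r r' -> reduced_mx rr' a \in unitmx.
Proof.
move=> Ha adj; rewrite unitmxE; set M := reduced_mx rr' a.
suff: `|\det M|%N == 1%N by case: (\det M) => [[|[|n]]|[|n]].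
apply: contraT => det_neq1.
have [q q_pr q_dvd] : exists2 q, prime q & (q %| `|\det M|)%N.
  (* Every prime divides a zero determinant, so 2 serves. *)
  case: `|_|%N det_neq1 => [|[|m]] // _; first by exists 2%N.
  by exists (pdiv m.+2); rewrite ?pdiv_prime ?pdiv_dvd.
have det0 : \det (map_mx (intr : int -> 'F_q) M) = 0.
  rewrite det_map_mx; have /dvdzP[k ->] : (q %| \det M)%Z by rewrite dvdzE.
  by rewrite rmorphM /= -[X in _ * X]/(q%:R) pchar_Fp_0 // mulr0.
(* [det0P] gives a left kernel vector, hence the transposition. *)
move/eqP: det0; rewrite -det_tr => /det0P[u u_neq0 uM].
case/eqP: u_neq0; apply: trmx_inj; rewrite trmx0.
apply: (reduced_mx_inj adj (version_inf_fin intr Ha)).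
rewrite -map_reduced_mx; apply: trmx_inj.
by rewrite trmx_mul trmxK uM trmx0.
Qed.

End KnotDiagram.

Theorem mainTheorem7 (D : diagram) (HD : knot_diagram D) :
  (forall (k : nat), (1 < k)%N ->
     forall a : vtx D -> reg D -> 'Z_k, version_fin a -> game_conclusion a) /\
  (forall a : vtx D -> reg D -> int, version_inf a -> game_conclusion a).
Proof.
split=> [k _ a Ha|a Ha].
  apply: game_conclusion_surj => // r r' rr' adj c.
  have inj : injective (mulmx (reduced_mx HD rr' a) : 'cV_#|vtx D| -> _).
    move=> x y /eqP; rewrite -subr_eq0 -mulmxBr => /eqP.
    by move/(reduced_mx_inj adj Ha)/eqP; rewrite subr_eq0 => /eqP.
  by have /codomP[x] := injF_onto inj c; exists x.
have Ha' : version_fin a by apply: (version_inf_fin idfun).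
apply: game_conclusion_surj => // r r' rr' adj c.
exists (mulmx (invmx (reduced_mx HD rr' a)) c).
by rewrite mulKVmx // reduced_mx_unit.
Qed.
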